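(* For every $c,\varepsilon>0$ there exists $\delta>0$ such that for every $p=p(n)$ with $\varepsilon/n \le p$ and $p\to 0$, there exists $n_0$ such that for every $n\ge n_0$, \[ \mathbb{P}\left( D(\mathcal{G}(n,p)) > \hat r + c\,\frac{\hat r}{n\sqrt{p}}\right) \ge \delta, \] where $\hat r = \min\{ r : \mathbb{E}(X_r) \ge 1/d\} - 1$.
   Context: $\mathcal{G}(n,p)$ is the Erdős–Rényi random graph on vertex set $[n]$ in which each pair is an edge independently with probability $p$. A set $S$ of vertices is dominating if every vertex is in $S$ or adjacent to a vertex of $S$; $D(G)$ is the minimum size of a dominating set. $X_r$ denotes the number of dominating sets of size $r$ in $\mathcal{G}(n,p)$, so $\mathbb{E}(X_r)=\binom{n}{r}(1-(1-p)^r)^{n-r}$. $d=np$. *)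

(* Defs.v *)
From HB Require Import structures.
From mathcomp Require Import all_boot all_order all_algebra.
From mathcomp Require Import all_classical all_reals all_analysis.

Set Implicit Arguments.
Unset Strict Implicit.
Unset Printing Implicit Defensive.

Import Order.TTheory GRing.Theory Num.Theory.
Import numFieldNormedType.Exports.

Local Open Scope ring_scope.

(* A simple graph on the vertex set 'I_n is given by its edge set, i.e. by a
   subset of vertex_pairs n. *)
Definition vertex_pairs (n : nat) : {set {set 'I_n}} :=
  [set e : {set 'I_n} | #|e| == 2%N].

Section Domination.
Context (n : nat) (G : {set {set 'I_n}}).

Definition adjacent (u v : 'I_n) : bool := [set u; v] \in G.

Definition dominating (S : {set 'I_n}) : bool :=
  [forall v, (v \in S) || [exists u in S, adjacent u v]].

(* The default value n of the minimum is attained by the full vertex set. *)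
Definition domination_number : nat :=
  \big[minn/n]_(S : {set 'I_n} | dominating S) #|S|.

Definition nb_dominating (r : nat) : nat :=
  #|[set S : {set 'I_n} | (#|S| == r) && dominating S]|.

Lemma domination_number_attained :
  exists2 S, dominating S & domination_number = #|S|.
Proof.
rewrite /domination_number.
apply: (big_ind (fun m => exists2 S, dominating S & m = #|S|)) => [|x y|S dS].
- exists [set: 'I_n]; last by rewrite cardsT card_ord.
  by apply/forallP => v; rewrite inE.
- by move=> xS yS; rewrite /minn; case: ifP.
- by exists S.
Qed.

Lemma domination_number_le S : dominating S -> (domination_number <= #|S|)%N.
Proof.
move=> dS; rewrite /domination_number.
have := mem_index_enum S; elim: (index_enum _) => // T s IHs.
rewrite in_cons big_cons => /predU1P[<-|/IHs le_s]; first by rewrite dS geq_minl.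
by case: ifP => // _; apply: leq_trans (geq_minr _ _) le_s.
Qed.

End Domination.

Section ErdosRenyi.
Context (R : realType) (n : nat) (p : R).

Definition gnp_mass (G : {set {set 'I_n}}) : R :=
  \prod_(e in vertex_pairs n) (if e \in G then p else 1 - p).

Definition gnp_pr (A : pred {set {set 'I_n}}) : R :=
  \sum_(G : {set {set 'I_n}} | (G \subset vertex_pairs n) && A G) gnp_mass G.

Definition gnp_expect (X : {set {set 'I_n}} -> R) : R :=
  \sum_(G : {set {set 'I_n}} | G \subset vertex_pairs n) gnp_mass G * X G.

Lemma gnp_prT : gnp_pr xpredT = 1.
Proof.
pose P := vertex_pairs n.
have := @bigA_distr R 0 1 *%R +%R _
                   (fun e => if e \in P then p else 0)
                   (fun e => if e \in P then 1 - p else 1).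
rewrite [X in X = _]big1 => [->|e _]; last first.
  by rewrite /=; case: ifP => _; rewrite ?add0r // addrC subrK.
rewrite /gnp_pr big_mkcond /=; apply: eq_bigr => G _; rewrite andbT.
case: ifPn => [sGP|/subsetPn[e eG eP]]; last first.
  by rewrite (bigD1 e) //= eG (negPf eP) mul0r.
rewrite /gnp_mass big_mkcond /=; apply: eq_bigr => e _.
have [eP|eP] := ifPn; first by [].
by case: ifP => // /(fintype.subsetP sGP); rewrite (negPf eP).
Qed.

Definition expected_dominating (r : nat) : R :=
  gnp_expect (fun G => (nb_dominating G r)%:R).

(* min {r : E(X_r) >= 1/d} - 1 with d = n p.  Only r <= n matter, as X_r = 0
   for r > n; the default n.+1 is returned when no r qualifies, which does not
   happen for n large under the assumptions p >= eps/n and p -> 0.  Since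
   X_0 = 0 for n > 0, the predecessor is not truncated when n, p > 0. *)
Definition rhat : nat :=
  (\big[minn/n.+1]_(0 <= r < n.+1
      | (n%:R * p)^-1 <= expected_dominating r) r).-1.

End ErdosRenyi.

(* Main.v *)
Require Import Defs.
From HB Require Import structures.
From mathcomp Require Import all_boot all_order all_algebra.
From mathcomp Require Import all_classical all_reals all_analysis.
From mathcomp Require Import ring lra zify.

Set Implicit Arguments.
Unset Strict Implicit.
Unset Printing Implicit Defensive.

Import Order.TTheory GRing.Theory Num.Theory.
Import numFieldNormedType.Exports.

Local Open Scope ring_scope.

(* Compare G(n,p) with G(n,p'), where p' := p - K sqrt p / n.  The two measures
   have chi-square distance bounded in terms of K, so an event of probability at
   least 1/2 under p' has probability bounded away from 0 under p.  Under p' the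
   first moment method applies.  Write rh for rhat, u := (1 - p)^rh, and
   r := rh + floor (c rh / (n sqrt p)).  By (n / rh)^rh <= 'C(n, rh) and
   E_p(X_rh) < 1/(n p), passing from rh to r multiplies the expected number of
   dominating sets by at most F := exp (c u / ((1 - u) sqrt p)), up to a power
   (n p)^(1 - r / rh) that matters only when n p is bounded; passing from p to p'
   divides it by at least F^2, once K is large, because p rh and 1 - r / n are
   bounded below.  If n p >= 2 then E_p'(X_r) <= 1/2 follows from
   E_p(X_rh) < 1/(n p); if eps <= n p < 2, from F -> oo as p -> 0. *)

(** * Independence over pairs and the closed form of $\mathbb{E}(X_r)$ *)

Section GnpMoments.
Variables (R : realType) (n : nat).
Implicit Types (p : R) (S T : {set 'I_n}) (F : {set {set 'I_n}}).

Lemma gnp_expect_prod p (g : {set 'I_n} -> bool -> R) :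
  gnp_expect p (fun G : {set {set 'I_n}} => \prod_(e in vertex_pairs n) g e (e \in G)) =
  \prod_(e in vertex_pairs n) (p * g e true + (1 - p) * g e false).
Proof.
(* Outside [vertex_pairs n] the two terms are 0 (present) and 1 (absent), so the expansion over all
   sets of sets kills every [G] that is not a graph. *)
pose P := vertex_pairs n.
have := @bigA_distr R 0 1 *%R +%R _
  (fun e => if e \in P then p * g e true else 0)
  (fun e => if e \in P then (1 - p) * g e false else 1).
rewrite (eq_bigr (fun e => if e \in P then p * g e true + (1 - p) * g e false
                           else 1)); last first.
  by move=> e _; case: ifP => //=; rewrite add0r.
rewrite -big_mkcond /= => ->.
rewrite /gnp_expect big_mkcond /=; apply: eq_bigr => G _.
case: ifPn => [sGP|/subsetPn[e eG eP]]; last first.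
  by rewrite (bigD1 e) //= eG (negPf eP) mul0r.
rewrite /gnp_mass -big_split /= big_mkcond /=; apply: eq_bigr => e _.
have [eP|eP] := ifPn; first by case: ifP.
by case: ifP => // /(fintype.subsetP sGP); rewrite (negPf eP).
Qed.

Lemma gnp_prE p (A : pred {set {set 'I_n}}) :
  gnp_pr p A = gnp_expect p (fun G => (A G)%:R).
Proof.
rewrite /gnp_pr /gnp_expect big_mkcondr /=; apply: eq_bigr => G _.
by case: (A G); rewrite ?mulr1 ?mulr0.
Qed.

Lemma eq_gnp_expect p (X Y : {set {set 'I_n}} -> R) :
  X =1 Y -> gnp_expect p X = gnp_expect p Y.
Proof. by move=> XY; apply: eq_bigr => G _; rewrite XY. Qed.

Lemma gnp_expect_sum p (I : finType) (P : pred I) (X : I -> {set {set 'I_n}} -> R) :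
  gnp_expect p (fun G => \sum_(i | P i) X i G) =
  \sum_(i | P i) gnp_expect p (X i).
Proof.
by rewrite /gnp_expect exchange_big /=; apply: eq_bigr => G _; rewrite mulr_sumr.
Qed.

Lemma gnp_expectZ p a (X : {set {set 'I_n}} -> R) :
  gnp_expect p (fun G => a * X G) = a * gnp_expect p X.
Proof. by rewrite mulr_sumr; apply: eq_bigr => G _; rewrite mulrCA. Qed.

Lemma gnp_mass_ge0 p (G : {set {set 'I_n}}) : 0 <= p <= 1 -> 0 <= gnp_mass p G.
Proof.
move=> /andP[p0 p1]; apply: prodr_ge0 => e _; case: ifP => // _.
by rewrite subr_ge0.
Qed.

Lemma gnp_expect_avoid p F : F \subset vertex_pairs n ->
  gnp_expect p (fun G => [disjoint F & G]%:R) = (1 - p) ^+ #|F|.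
Proof.
move=> sFP.
transitivity (gnp_expect p (fun G : {set {set 'I_n}} =>
    \prod_(e in vertex_pairs n) ((e \in F) ==> ~~ (e \in G))%:R)).
  apply: eq_gnp_expect => G; have [dFG|ndFG] := boolP [disjoint F & G].
    rewrite big1 // => e _; apply/eqP; rewrite (_ : _ ==> _) //.
    by apply/implyP => eF; rewrite (disjointFr dFG).
  move: ndFG; rewrite -finset.setI_eq0 => /set0Pn[e]; rewrite inE => /andP[eF eG].
  by rewrite (bigD1 e) ?(fintype.subsetP sFP) //= eF eG /= mul0r.
rewrite (gnp_expect_prod p (fun e b => ((e \in F) ==> ~~ b)%:R)) /=.
rewrite (eq_bigr (fun e => if e \in F then 1 - p else 1)); last first.
  move=> e _; case: (e \in F) => /=; first by rewrite mulr0 add0r mulr1.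
  by rewrite !mulr1 addrC subrK.
rewrite -big_mkcondr /= -prodr_const; apply: eq_bigl => e.
by case: (boolP (e \in F)) => [eF|]; rewrite ?andbT ?andbF ?(fintype.subsetP sFP).
Qed.

Definition cut_pairs S T : {set {set 'I_n}} :=
  [set [set z.1; z.2] | z in finset.setX S T].

Lemma cut_pairs_sub S T : [disjoint S & T] -> cut_pairs S T \subset vertex_pairs n.
Proof.
move=> dST; apply/fintype.subsetP => e /imsetP[[u v]]; rewrite inE /= => /andP[uS vT] ->.
rewrite inE cards2; case: (u =P v) => // uv.
by move: vT; rewrite -uv (disjointFr dST).
Qed.

(** Disjointness of [S] and [T] allows $(u,v)$ to be recovered from the unordered pair. *)
Lemma card_cut_pairs S T : [disjoint S & T] -> #|cut_pairs S T| = (#|S| * #|T|)%N.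
Proof.
move=> dST; rewrite card_in_imset ?cardsX // => -[u v] [u' v'].
rewrite !inE /= => /andP[uS vT] /andP[u'S v'T] /setP E.
have := E u; rewrite !inE eqxx /= => /esym/orP[|/eqP uv'] ; last first.
  by move: v'T; rewrite -uv' (disjointFr dST).
move=> /eqP uu'; have := E v; rewrite !inE eqxx orbT => /esym/orP[/eqP vu'|/eqP ->].
  by move: vT; rewrite vu' (disjointFr dST).
by rewrite uu'.
Qed.

Lemma disjoint_cut_pairs S T (G : {set {set 'I_n}}) :
  [disjoint cut_pairs S T & G] =
  [forall v in T, ~~ [exists u in S, Defs.adjacent G u v]].
Proof.
apply/idP/forall_inP => [d v vT|H].
  apply/exists_inPn => u uS; rewrite /Defs.adjacent.
  rewrite (disjointFr d) //; apply/imsetP; exists (u, v) => //.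
  by rewrite inE uS vT.
rewrite disjoint_subset; apply/fintype.subsetP => e /imsetP[[u v]].
rewrite inE /= => /andP[uS vT] ->; rewrite inE.
by have /exists_inPn/(_ u uS) := H v vT.
Qed.

(* Inclusion-exclusion over the set [T] of vertices outside [S] that are not
   dominated: [T] is undominated iff the [#|S| * #|T|] pairs between [S] and [T]
   are all missing. *)
Lemma gnp_pr_dominating p S :
  gnp_pr p (fun G => dominating G S) = (1 - (1 - p) ^+ #|S|) ^+ (n - #|S|).
Proof.
have -> : (n - #|S|)%N = #|~: S| by rewrite [RHS]cardsCs finset.setCK card_ord.
rewrite gnp_prE.
pose b (G : {set {set 'I_n}}) v := [exists u in S, Defs.adjacent G u v].
transitivity (gnp_expect p (fun G : {set {set 'I_n}} =>
  \sum_(T : {set 'I_n} | T \subset ~: S)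
     ((-1) ^+ #|T| * [disjoint cut_pairs S T & G]%:R))).
  apply: eq_gnp_expect => G.
  (* Each factor is $1 - [v \text{ undominated}]$, and it is 1 on [S]; expanding the product selects
     the set [T]. *)
  have -> : (dominating G S)%:R = \prod_(v : 'I_n)
     ((if v \in S then 0 else - (~~ b G v)%:R) + 1) :> R.
    have [/forallP dS|/forallPn[v]] := boolP (dominating G S).
      rewrite big1 // => v _; have := dS v; case: (v \in S) => /=.
        by rewrite add0r.
      by rewrite -/(b G v) => ->; rewrite oppr0 add0r.
    rewrite negb_or -/(b G v) => /andP[vS nb].
    by rewrite (bigD1 v) //= (negPf vS) nb addNr mul0r.
  rewrite bigA_distr [RHS]big_mkcond /=; apply: eq_bigr => T _.
  case: ifPn => [sTS|/subsetPn[v vT]]; last first.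
    by rewrite inE negbK => vS; rewrite (bigD1 v) //= vT vS mul0r.
  rewrite -big_mkcond /= (eq_bigr (fun v => -1 * (~~ b G v)%:R)); last first.
    move=> v /(fintype.subsetP sTS); rewrite inE => /negPf ->.
    by rewrite mulN1r.
  rewrite big_split /= prodr_const disjoint_cut_pairs; congr (_ * _).
  have [/forall_inP H|/forall_inPn[v vT]] :=
    boolP [forall v in T, ~~ [exists u in S, Defs.adjacent G u v]].
    by rewrite big1 // => v vT; rewrite H.
  by rewrite negbK => bv; rewrite (bigD1 v) //= /b bv mul0r.
rewrite gnp_expect_sum.
(* The same expansion read backwards, now with the probability $(1-p)^{|S||T|}$ in place of the
   indicator. *)
transitivity (\prod_(v : 'I_n) ((if v \in S then 0 else - (1 - p) ^+ #|S|) + 1)).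
  rewrite bigA_distr big_mkcond /=; apply: eq_bigr => T _.
  case: ifPn => [sTS|/subsetPn[v vT]]; last first.
    by rewrite inE negbK => vS; rewrite (bigD1 v) //= vT vS mul0r.
  have dST : [disjoint S & T] by rewrite disjoint_sym finset.disjoints_subset.
  rewrite gnp_expectZ gnp_expect_avoid ?cut_pairs_sub // card_cut_pairs //.
  rewrite -big_mkcond /= (eq_bigr (fun v => - (1 - p) ^+ #|S|)); last first.
    by move=> v /(fintype.subsetP sTS); rewrite inE => /negPf ->.
  by rewrite prodr_const exprM -exprMn mulN1r.
rewrite -[RHS]prodr_const [RHS]big_mkcond /=; apply: eq_bigr => v _.
by rewrite inE; case: (v \in S); rewrite /= ?add0r // addrC.
Qed.

Lemma expected_dominatingE p r : expected_dominating n p r =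
  'C(n, r)%:R * (1 - (1 - p) ^+ r) ^+ (n - r).
Proof.
rewrite /expected_dominating.
transitivity (gnp_expect p (fun G => \sum_(S : {set 'I_n} | #|S| == r) (dominating G S)%:R : R)).
  apply: eq_gnp_expect => G; rewrite /nb_dominating -sum1_card natr_sum.
  rewrite (eq_bigl (fun S : {set 'I_n} => (#|S| == r) && dominating G S));
    last by move=> S; rewrite inE.
  by rewrite big_mkcondr /=; apply: eq_bigr => S _; case: (dominating G S).
rewrite gnp_expect_sum (eq_bigr (fun=> (1 - (1 - p) ^+ r) ^+ (n - r))); last first.
  by move=> S /eqP Sr; rewrite -gnp_prE gnp_pr_dominating Sr.
rewrite (eq_bigl (fun S : {set 'I_n} => S \in [set S : {set 'I_n} | #|S| == r]));
  last by move=> S; rewrite inE.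
by rewrite sumr_const card_draws card_ord mulr_natl.
Qed.

End GnpMoments.

(** * First moment method, change of measure, and the minimum behind [rhat] *)

Section GnpBounds.
Variables (R : realType) (n : nat).
Implicit Types (p : R) (G : {set {set 'I_n}}) (A : pred {set {set 'I_n}}).

Lemma gnp_prC p A : gnp_pr p A = 1 - gnp_pr p (predC A).
Proof.
have E : gnp_pr p (fun _ : {set {set 'I_n}} => true) = gnp_pr p A + gnp_pr p (predC A).
  by rewrite /gnp_pr (bigID A) /=; congr (_ + _); apply: eq_bigl => G; rewrite andbT.
by have := gnp_prT n p; rewrite E => <-; rewrite addrK.
Qed.

Lemma dominatingS G (S T : {set 'I_n}) :
  S \subset T -> dominating G S -> dominating G T.
Proof.
move=> /fintype.subsetP sST /forallP dS; apply/forallP => v.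
have /orP[/sST -> //|/exists_inP[u /sST uT uv]] := dS v.
by apply/orP; right; apply/exists_inP; exists u.
Qed.

(** A minimum dominating set is padded with outside vertices up to size exactly [k]. *)
Lemma nb_dominating_gt0 G k : (k <= n)%N -> (domination_number G <= k)%N ->
  (0 < nb_dominating G k)%N.
Proof.
move=> kn; have [S dS ->] := domination_number_attained G => Sk.
have cS : #|~: S| = (n - #|S|)%N by rewrite [LHS]cardsCs finset.setCK card_ord.
have : (0 < #|[set B : {set 'I_n} | B \subset ~: S & #|B| == k - #|S|]|)%N.
  by rewrite cards_draws bin_gt0 cS leq_sub2r.
rewrite card_gt0 => /set0Pn[B]; rewrite inE => /andP[sBS /eqP cB].
rewrite card_gt0; apply/set0Pn; exists (S :|: B); rewrite inE.
rewrite (dominatingS _ dS) ?finset.subsetUl // andbT cardsU.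
have -> : S :&: B = finset.set0.
  by apply/eqP; rewrite finset.setI_eq0 disjoint_sym finset.disjoints_subset.
by rewrite cards0 subn0 cB subnKC.
Qed.

Lemma gnp_pr_domination_le p k : 0 <= p <= 1 -> (k <= n)%N ->
  gnp_pr p (fun G => (domination_number G <= k)%N) <= expected_dominating n p k.
Proof.
move=> p01 kn; rewrite gnp_prE; apply: ler_sum => G _.
apply: ler_wpM2l; first exact: gnp_mass_ge0.
case: leqP => // Dk; rewrite ler_nat; exact: nb_dominating_gt0.
Qed.

Lemma gnp_pr_le p A B : 0 <= p <= 1 -> {subset A <= B} -> gnp_pr p A <= gnp_pr p B.
Proof.
move=> p01 AB; rewrite !gnp_prE; apply: ler_sum => G _.
apply: ler_wpM2l; first exact: gnp_mass_ge0.
by rewrite ler_nat; case AG: (A G) => //; have := AB G; rewrite unfold_in AG unfold_in => ->.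
Qed.

(* With [L] the likelihood ratio of the two measures, sum the inequality
   [L <= B + L^2 / (4 B)], using [E(L^2) <= B]. *)
Lemma gnp_pr_change p p' (B : R) A : 0 < p < 1 -> 0 <= p' <= 1 -> 0 < B ->
  (1 + (p' - p) ^+ 2 / (p * (1 - p))) ^+ #|vertex_pairs n| <= B ->
  gnp_pr p' A <= B * gnp_pr p A + 4^-1.
Proof.
move=> /andP[p0 p1] p'01 B0 hB.
have q0 : 0 < 1 - p by rewrite subr_gt0.
pose l b := if b then p' / p else (1 - p') / (1 - p).
pose L G := \prod_(e in vertex_pairs n) l (e \in G).
have mass' G : gnp_mass p' G = gnp_mass p G * L G.
  rewrite -big_split; apply: eq_bigr => e _ /=; rewrite /l.
  by case: ifP => _; rewrite mulrC divfK // gt_eqF.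
(* The second moment factorizes; each pair contributes $p'^2/p + (1-p')^2/(1-p) = 1 +
   (p'-p)^2/(p(1-p))$. *)
have EL : gnp_expect p (fun G => L G ^+ 2) <= B.
  apply: le_trans hB; rewrite le_eqVlt; apply/orP; left; apply/eqP.
  rewrite (eq_gnp_expect p (Y := fun G =>
    \prod_(e in vertex_pairs n) (l (e \in G)) ^+ 2)); last first.
    by move=> G; rewrite -prodrXl.
  rewrite (gnp_expect_prod p (fun _ b => l b ^+ 2)) prodr_const /l /=.
  by congr (_ ^+ _); field; rewrite !gt_eqF.
rewrite !gnp_prE.
have -> : gnp_expect p' (fun G => (A G)%:R) = gnp_expect p (fun G => (A G)%:R * L G).
  by apply: eq_bigr => G _; rewrite mass' mulrAC mulrA.
apply: (@le_trans _ _ (B * gnp_expect p (fun G => (A G)%:R) +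
  (4 * B)^-1 * gnp_expect p (fun G => L G ^+ 2))); last first.
  rewrite lerD2l mulrC ler_pdivrMr ?mulr_gt0 //; apply: (le_trans EL).
  by rewrite mulrA mulVf ?mul1r // pnatr_eq0.
rewrite -!gnp_expectZ -big_split /=; apply: ler_sum => G _ /=.
rewrite -mulrDr; apply: ler_wpM2l.
  by apply: gnp_mass_ge0; rewrite !ltW.
have h : 0 <= B + (4 * B)^-1 * L G ^+ 2 - L G.
  have -> : B + (4 * B)^-1 * L G ^+ 2 - L G = (2 * B - L G) ^+ 2 / (4 * B).
    by field; rewrite gt_eqF.
  by rewrite divr_ge0 ?sqr_ge0 // mulr_ge0 // ltW.
case: (A G); first by move: h; rewrite subr_ge0 mul1r mulr1.
by rewrite mul0r mulr0 add0r mulr_ge0 ?sqr_ge0 // invr_ge0 mulr_ge0 // ltW.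
Qed.

Lemma card_vertex_pairs : #|vertex_pairs n| = 'C(n, 2).
Proof. by rewrite -[in RHS](card_ord n) -card_draws. Qed.

Lemma bigmin_nat_spec m0 m (P : pred nat) :
  let M := \big[minn/m0]_(0 <= r < m | P r) r in
  (M < m0 -> P M)%N /\ forall r, (r < m)%N -> P r -> (M <= r)%N.
Proof.
move=> M; split.
  rewrite /M; elim/big_ind: _ => [|x y hx hy|i Pi _ //]; first by rewrite ltnn.
  by rewrite /minn; case: ifP.
move=> r rm Pr; rewrite /M.
have : r \in index_iota 0 m by rewrite mem_index_iota.
elim: (index_iota 0 m) => // a s IH; rewrite in_cons big_cons => /predU1P[<-|/IH h].
  by rewrite Pr geq_minl.
case: ifP => _ //; exact: leq_trans (geq_minr _ _) h.
Qed.

(** A qualifying [s] rules out the default of the minimum, and the hypothesis at 0 makes the minimum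
    positive, so that [.-1] is a true predecessor. *)
Lemma rhat_spec p s : (s <= n)%N ->
  expected_dominating n p 0 < (n%:R * p)^-1 ->
  (n%:R * p)^-1 <= expected_dominating n p s ->
  [/\ (rhat n p < s)%N, expected_dominating n p (rhat n p) < (n%:R * p)^-1
    & (n%:R * p)^-1 <= expected_dominating n p (rhat n p).+1].
Proof.
move=> sn h0 hs.
pose P r := (n%:R * p)^-1 <= expected_dominating n p r.
have [] := @bigmin_nat_spec n.+1 n.+1 P.
rewrite /rhat -/(P _); set M := \big[_/_]_(_ <= _ < _ | _) _ => hM hle.
have Ms : (M <= s)%N by apply: hle.
have PM : P M by apply: hM; rewrite ltnS (leq_trans Ms).
have M0 : (0 < M)%N by rewrite lt0n; apply/eqP => M0; move: PM; rewrite M0 /P leNgt h0.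
have M1 : (M.-1 < M)%N by rewrite prednK.
split; [exact: leq_trans Ms | | by rewrite prednK].
rewrite ltNge; apply/negP => h; have := hle M.-1.
by rewrite ltnS (leq_trans (leq_pred _) (leq_trans Ms sn)) => /(_ erefl h); rewrite leqNgt M1.
Qed.

End GnpBounds.

(** * Bounds on binomial coefficients *)

Lemma bin_ge_exp n r : (r <= n)%N -> (n ^ r <= 'C(n, r) * r ^ r)%N.
Proof.
elim: r n => [|r IH] [|n] //; rewrite ltnS => rn.
rewrite [(r.+1 ^ r.+1)%N]expnS mulnA [('C(_, _) * _)%N]mulnC -mul_bin_diag /=.
rewrite expnS -mulnA leq_mul2l /=.
case: r => [|r] in IH rn *; first by rewrite !expn0 bin0.
rewrite -(leq_pmul2r (expn_gt0 r.+1 r.+1)).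
(* For $j \le n$ one has $(n+1)/(j+1) \le n/j$, here with $j = r+1$. *)
apply: (@leq_trans (n ^ r.+1 * r.+2 ^ r.+1)).
  by rewrite -!expnMn leq_exp2r //; nia.
by rewrite mulnAC; apply: leq_mul => //; apply: IH.
Qed.

(** Each unit step multiplies the coefficient by $(n-r-j)/(r+j+1) \le n/r$. *)
Lemma bin_addn_le n r k : ('C(n, r + k) * r ^ k <= 'C(n, r) * n ^ k)%N.
Proof.
elim: k => [|k IH]; first by rewrite addn0.
have h : ('C(n, (r + k).+1) * r <= 'C(n, r + k) * n)%N.
  apply: (@leq_trans ((r + k).+1 * 'C(n, (r + k).+1))).
    by rewrite mulnC leq_mul2r; apply/orP; right; lia.
  by rewrite mul_bin_left mulnC leq_mul2l leq_subr orbT.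
rewrite addnS !expnS mulnA.
apply: (@leq_trans ('C(n, r + k) * n * r ^ k)); first by rewrite leq_mul2r h orbT.
by rewrite mulnAC [(n * n ^ k)%N]mulnC mulnA leq_mul2r IH orbT.
Qed.

Lemma bin_le_exp2 n r : ('C(n, r) <= 2 ^ n)%N.
Proof.
rewrite -{1}(card_ord n) -card_draws.
apply: (@leq_trans #|powerset [set: 'I_n]|); last by rewrite card_powerset cardsT card_ord.
by apply: subset_leq_card; apply/fintype.subsetP => A _; rewrite inE finset.subsetT.
Qed.

(** * Estimates of $\mathbb{E}(X_r)$ at small, large and shifted arguments *)

Section Estimates.
Variable R : realType.
Implicit Types (p c K x : R) (n r k m : nat).

Lemma bernoulli_ineq x k : -1 <= x -> 1 + k%:R * x <= (1 + x) ^+ k.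
Proof.
move=> x1; elim: k => [|k IH]; first by rewrite mul0r addr0 expr0.
rewrite exprS; apply: le_trans (ler_wpM2l _ IH); last by lra.
rewrite -natr1; have : 0 <= k%:R :> R by []. nra.
Qed.

Lemma expRN2_le p : 0 <= p <= 2^-1 -> expR (- (2 * p)) <= 1 - p.
Proof.
move=> /andP[p0 p1]; rewrite expRN -[1 - p]invrK lef_pV2 ?posrE ?expR_gt0 ?invr_gt0 //;
  last by lra.
apply: (@le_trans _ _ (1 + 2 * p)); last exact: expR_ge1Dx.
by rewrite -[_^-1]mul1r ler_pdivrMr; nra.
Qed.

(** This is $\binom{n}{r+k} \le \binom{n}{r}^{1+k/r}$, from $\binom{n}{r+k} \le \binom{n}{r}(n/r)^k$
    and $(n/r)^r \le \binom{n}{r}$. *)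
Lemma ln_bin_addn n r k : (0 < r)%N -> (r + k <= n)%N ->
  r%:R * ln ('C(n, r + k)%:R : R) <= (r + k)%:R * ln ('C(n, r)%:R : R).
Proof.
move=> r0 rkn; have n0 : (0 < n)%N by lia.
have rn : (r <= n)%N by lia.
have Pn m : (0 < m)%N -> (m%:R : R) \is Num.pos by rewrite posrE ltr0n.
have lnMX m i j : (0 < m)%N -> (0 < i)%N ->
    ln ((m * i ^ j)%N%:R : R) = ln m%:R + j%:R * ln i%:R.
  move=> m0 i0; rewrite natrM natrX lnM ?Pn ?posrE ?exprn_gt0 ?ltr0n //.
  by rewrite lnXn ?ltr0n // mulr_natl.
have h1 := bin_addn_le n r k; have h2 := bin_ge_exp rn.
have b0 : (0 < 'C(n, r))%N by rewrite bin_gt0.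
have b1 : (0 < 'C(n, r + k))%N by rewrite bin_gt0.
have : ln (('C(n, r + k) * r ^ k)%N%:R : R) <= ln (('C(n, r) * n ^ k)%N%:R : R).
  by rewrite ler_ln ?Pn ?muln_gt0 ?expn_gt0 ?b0 ?b1 ?r0 ?n0 ?ler_nat.
have : ln ((1 * n ^ r)%N%:R : R) <= ln (('C(n, r) * r ^ r)%N%:R : R).
  by rewrite ler_ln ?Pn ?muln_gt0 ?expn_gt0 ?b0 ?b1 ?r0 ?n0 ?ler_nat ?mul1n.
rewrite !lnMX // ln1 add0r natrD => e1 e2.
have k0 : 0 <= k%:R :> R by []. have r0' : 0 <= r%:R :> R by [].
have := ler_wpM2l r0' e2; have := ler_wpM2l k0 e1; lra.
Qed.

(** An outside vertex is dominated with probability at most $pr \le 1/16$, so $\mathbb{E}(X_r) \le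
    2^n 16^{-n/2} = 2^{-n} < 1/n$. This later bounds $p\hat r$ from below. *)
Lemma expected_dominating_small n p r : 0 < p <= 1 -> (0 < n)%N -> (2 * r <= n)%N ->
  p * r%:R <= 16^-1 -> expected_dominating n p r < (n%:R * p)^-1.
Proof.
move=> /andP[p0 p1] n0 rn pr; rewrite expected_dominatingE.
have np0 : 0 < n%:R * p by rewrite mulr_gt0 ?ltr0n.
have u0 : 0 <= 1 - (1 - p) ^+ r.
  by rewrite subr_ge0 exprn_ile1 //; lra.
have u1 : 1 - (1 - p) ^+ r <= 4^-1 ^+ 2.
  have := @bernoulli_ineq (- p) r; rewrite lerN2 => /(_ p1).
  have -> : 4^-1 ^+ 2 = 16^-1 :> R by field.
  by move: pr; lra.
apply: (@le_lt_trans _ _ (2 ^+ n * (4^-1) ^+ n)).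
  apply: ler_pM => //; first exact: exprn_ge0.
    by rewrite -natrX ler_nat bin_le_exp2.
  apply: (@le_trans _ _ ((4^-1 ^+ 2) ^+ (n - r))).
    by apply: lerXn2r; rewrite ?nnegrE // exprn_ge0 // invr_ge0.
  rewrite -exprM; apply: ler_wiXn2l; [by rewrite invr_ge0| |by lia].
  by rewrite invf_le1 // ler1n.
rewrite -exprMn.
have -> : 2 * 4^-1 = 2^-1 :> R by field.
rewrite exprVn ltf_pV2 ?posrE ?exprn_gt0 //.
apply: (@le_lt_trans _ _ n%:R); first by rewrite ler_piMr.
by rewrite -natrX ltr_nat ltn_expl.
Qed.

(** With $u = 1-(1-p)^{n-m} \ge 1-e^{-\varepsilon/2}$, the expectation is at least $(nu/m)^m \ge 2^m
    \ge 1/\varepsilon$. This later keeps $\hat r$ a linear distance below $n$. *)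
Lemma expected_dominating_large n p eps m : 0 < p <= 1 -> 0 < eps <= n%:R * p ->
  (0 < m)%N -> (2 * m <= n)%N ->
  m%:R <= (1 - expR (- (eps / 2))) / 2 * n%:R -> eps^-1 <= 2 ^+ m ->
  (n%:R * p)^-1 <= expected_dominating n p (n - m).
Proof.
move=> /andP[p0 p1] /andP[e0 ed] m0 mn mle hm.
have n0 : (0 < n)%N by lia.
rewrite expected_dominatingE bin_sub ?subKn; try lia.
apply: (@le_trans _ _ eps^-1); first by rewrite lef_pV2 ?posrE // (lt_le_trans e0).
apply: (le_trans hm).
set u := 1 - _.
have hu : 1 - expR (- (eps / 2)) <= u.
  rewrite lerD2l lerN2.
  apply: (@le_trans _ _ (expR (- p) ^+ (n - m))).
    apply: lerXn2r; rewrite ?nnegrE ?expR_ge0 ?subr_ge0 //.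
    exact: expR_ge1Dx.
  rewrite -expRM_natr ler_expR mulNr lerN2 natrB; last by lia.
  have : m%:R *+ 2 <= n%:R :> R by rewrite -mulr_natr -natrM ler_nat; lia.
  by rewrite -mulr_natr; nra.
have m0' : 0 < m%:R :> R by rewrite ltr0n.
have -> : 'C(n, m)%:R * u ^+ m = ('C(n, m) * m ^ m)%:R * (u / m%:R) ^+ m :> R.
  by rewrite natrM natrX -mulrA -exprMn; congr (_ * _ ^+ _); field; rewrite gt_eqF.
have u0 : 0 <= u.
  apply: le_trans hu; rewrite subr_ge0 -ler_ln ?posrE ?expR_gt0 // expRK ln1; lra.
apply: (@le_trans _ _ (n%:R ^+ m * (u / m%:R) ^+ m)).
  rewrite -exprMn; apply: lerXn2r; rewrite ?nnegrE ?mulr_ge0 ?invr_ge0 //.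
  by rewrite mulrA ler_pdivlMr //; nra.
rewrite -natrX; apply: ler_wpM2r; first by rewrite exprn_ge0 // divr_ge0.
by rewrite ler_nat bin_ge_exp //; lia.
Qed.

(** Since $(1-p)(1+h) \le 1-p+h$, Bernoulli's inequality gives the gain over [r] factors and bounds
    the loss from the [k] extra ones. *)
Lemma pow_perturb p h r k : 0 <= p < 1 -> 0 <= h -> k%:R * p <= 1 ->
  (1 - p) ^+ r * ((1 + r%:R * h) * (1 - k%:R * p)) <= (1 - (p - h)) ^+ (r + k).
Proof.
move=> /andP[p0 p1] h0 kp; rewrite exprD mulrA.
have q0 : 0 <= 1 - p by lra.
apply: ler_pM.
- by rewrite mulr_ge0 ?exprn_ge0 // addr_ge0 // mulr_ge0.
- by lra.
- apply: (@le_trans _ _ ((1 - p) ^+ r * (1 + h) ^+ r)).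
    by rewrite ler_wpM2l ?exprn_ge0 // bernoulli_ineq //; lra.
  by rewrite -exprMn; apply: lerXn2r; rewrite ?nnegrE; nra.
- apply: (@le_trans _ _ ((1 - p) ^+ k)).
    by have := @bernoulli_ineq (- p) k; rewrite mulrN; apply; lra.
  by apply: lerXn2r; rewrite ?nnegrE; lra.
Qed.

(** The real arithmetic of the next lemma, its logarithms made variables: [a], [b] stand for those
    of the binomials at $r$ and $r+k$, [L1], [L2] for those of $1-u$ and $1-u'$, [D] for
    $\ln(np)$. *)
Lemma shift_arith (N rr kk a b D L1 L2 w x K c s eta1 eta2 : R) :
  0 < s -> 0 < c -> 0 < K -> 0 < N -> 0 < rr -> 0 <= kk -> 0 < w -> 0 < eta2 ->
  x = rr * s / N -> kk * (N * s) <= c * rr ->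
  eta2 * N <= N - (rr + kk) -> eta1 <= s ^+ 2 * rr -> 8 * c <= eta1 * eta2 * K ->
  rr * b <= (rr + kk) * a -> a + (N - rr) * L1 < - D ->
  - L1 <= w -> L2 <= L1 - K / 4 * x * w ->
  rr * (b + (N - (rr + kk)) * L2) <= - (rr * (c / s * w)) - (rr + kk) * D.
Proof.
move=> s0 c0 K0 n0 r0' k0 w0 e20 Ex hk he2 he1 hK hab ha Lw L'.
have x0 : 0 < x by rewrite Ex divr_gt0 // mulr_gt0.
have rk0 : 0 < rr + kk by lra.
have step1 : rr * (b + (N - (rr + kk)) * L2) <=
    - (N * kk * L1) - (rr + kk) * D - rr * ((N - (rr + kk)) * (K / 4 * x * w)).
  have M0 : 0 <= rr * (N - (rr + kk)).
    by rewrite mulr_ge0 ?(ltW r0') //; apply: le_trans he2; rewrite mulr_ge0 ?ltW.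
  have := ler_wpM2l M0 L'.
  have := ler_wpM2l (ltW rk0) (ltW ha).
  lra.
(* The cost of growing $r$ to $r+k$; [step3] shows that the gain from lowering $p$ is at least twice
   as large. *)
have step2 : - (N * kk * L1) <= rr * (c / s * w).
  apply: (@le_trans _ _ (N * kk * w)).
    by rewrite -mulrN ler_wpM2l // mulr_ge0 // ltW.
  rewrite mulrA ler_pM2r // mulrA ler_pdivlMr //; lra.
have step3 : 2 * (c / s * w) <= (N - (rr + kk)) * (K / 4 * x * w).
  have Kxw : 0 <= K / 4 * x * w by rewrite !mulr_ge0 ?ltW.
  apply: le_trans (ler_wpM2r Kxw he2).
  have -> : eta2 * N * (K / 4 * x * w) = (eta2 * K / 4) * (s ^+ 2 * rr) / s * w.
    by rewrite Ex; field; rewrite !gt_eqF.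
  rewrite mulrA ler_pM2r // mulrA ler_pM2r ?invr_gt0 //.
  have E0 : 0 <= eta2 * K / 4 by rewrite !mulr_ge0 ?ltW.
  have := ler_wpM2l E0 he1; lra.
have := ler_wpM2l (ltW r0') step3.
lra.
Qed.

(* The growth [r -> r + k] is paid for by the binomial bound [ln_bin_addn], i.e.
   by [ln 'C(n, r) < - (n - r) * ln (1 - (1 - p) ^+ r) - ln (n p)]; the loss
   [p -> p - K s / n] gains [(n - r - k) * (K / 4) * (r s / n) * w] with
   [w := u / (1 - u)] and [u := (1 - p) ^+ r], which is twice as large. *)
Lemma ln_expected_dominating_shift n r k (s c K eta1 eta2 : R) :
  let p := s ^+ 2 in
  0 < s -> p <= 2^-1 -> 0 < c -> (0 < r)%N ->
  k%:R * (n%:R * s) <= c * r%:R -> c * s <= 2^-1 -> 4 * c <= K -> K < n%:R * s ->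
  0 < eta2 -> eta2 * n%:R <= n%:R - (r + k)%:R ->
  eta1 <= p * r%:R -> 8 * c <= eta1 * eta2 * K ->
  expected_dominating n p r < (n%:R * p)^-1 ->
  r%:R * ln (expected_dominating n (p - K * s / n%:R) (r + k)) <=
  - (r%:R * (c / s * (1 - p) ^+ r)) - (r + k)%:R * ln (n%:R * p).
Proof.
move=> p s0 p2 c0 r0 hk cs cK Kns e20 he2 he1 hK; rewrite !expected_dominatingE.
have K0 : 0 < K by lra.
have ns0 : 0 < n%:R * s by apply: lt_trans Kns.
have n0 : 0 < n%:R :> R by rewrite -(pmulr_lgt0 _ s0).
have p0 : 0 < p by rewrite exprn_gt0.
have r0' : 0 < r%:R :> R by rewrite ltr0n.
have rkn : (r + k < n)%N.
  have en0 : 0 < eta2 * n%:R by rewrite mulr_gt0.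
  by rewrite -(ltr_nat R); lra.
have rn : (r <= n)%N by rewrite (leq_trans (leq_addr k r)) // ltnW.
have rk_neq0 : (r + k)%N != 0 by rewrite addn_eq0 negb_and -lt0n r0.
set p' := p - _.
have h0 : 0 < K * s / n%:R by rewrite !divr_gt0 ?mulr_gt0.
have p'0 : 0 < p'.
  rewrite subr_gt0 ltr_pdivrMr // /p expr2 mulrAC.
  by rewrite ltr_pM2r // mulrC.
have p'p : p' < p by rewrite /p'; lra.
set u := (1 - p) ^+ r; set u' := (1 - p') ^+ (r + k).
pose x := r%:R * s / n%:R.
have x0 : 0 < x by rewrite divr_gt0 // mulr_gt0.
have xs : x <= s.
  by rewrite ler_pdivrMr // mulrC ler_pM2l // ler_nat.
have kx : k%:R * p <= c * x.
  rewrite /x mulrA ler_pdivlMr // /p.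
  have := ler_wpM2r (ltW s0) hk; nra.
have cx : c * x <= 2^-1 by apply: le_trans cs; rewrite ler_pM2l.
have u0 : 0 < u by rewrite exprn_gt0 //; lra.
(* Of $Kx$, at most $Kx/4$ is lost through $cx$ (as $4c \le K$) and at most $Kx/2$ through $Kx \cdot
   cx$ (as $cx \le 1/2$). *)
have uu' : u * (1 + K / 4 * x) <= u'.
  have := @pow_perturb p (K * s / n%:R) r k; rewrite -/p' -/u -/u'.
  have -> : r%:R * (K * s / n%:R) = K * x by rewrite /x; field; rewrite gt_eqF.
  move=> H; apply: le_trans (H _ _ _); [|lra|lra|lra].
  rewrite ler_pM2l //.
  have Kx : 0 < K * x by rewrite mulr_gt0.
  have : 0 <= (1 + K * x) * (c * x - k%:R * p) by rewrite mulr_ge0; lra.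
  have : 0 <= K * x * (2^-1 - c * x) by rewrite mulr_ge0; lra.
  have : 0 <= (K - 4 * c) * x by rewrite mulr_ge0; lra.
  lra.
have u1 : u < 1 by rewrite exprn_ilt1 ?gtn_eqF //; lra.
have u'1 : u' < 1 by rewrite exprn_ilt1 //; lra.
have b0 : (0 : R) < 'C(n, r)%:R by rewrite ltr0n bin_gt0.
have b1 : (0 : R) < 'C(n, r + k)%:R by rewrite ltr0n bin_gt0 ltnW.
have d0 : 0 < n%:R * p by rewrite mulr_gt0.
have U : 0 < 1 - u by lra.
have U' : 0 < 1 - u' by lra.
rewrite -ltr_ln ?posrE ?invr_gt0 // ?mulr_gt0 ?exprn_gt0 //.
rewrite lnV ?posrE // !lnM ?posrE ?exprn_gt0 // !lnXn // -!(mulr_natl (ln _)).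
rewrite !natrB ?(ltnW rkn) //.
have := ln_bin_addn r0 (ltnW rkn).
move: (ln 'C(n, r)%:R) (ln 'C(n, r + k)%:R) (ln (n%:R * p)) => a b D hab ha.
pose w := u / (1 - u).
have w0 : 0 < w by rewrite divr_gt0.
have uw : u <= w by rewrite ler_pdivlMr // ler_piMr //; lra.
have Lw : - ln (1 - u) <= w.
  have -> : - ln (1 - u) = ln (1 + w).
    rewrite -lnV ?posrE //; congr ln; rewrite /w; field; lra.
  by apply: le_ln1Dx; lra.
have L' : ln (1 - u') <= ln (1 - u) - K / 4 * x * w.
  have -> : 1 - u' = (1 - u) * (1 + - ((u' - u) / (1 - u))) by field; lra.
  have t : (u' - u) / (1 - u) < 1 by rewrite ltr_pdivrMr //; lra.
  rewrite lnM ?posrE //; last by lra.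
  rewrite lerD2l; apply: (le_trans (le_ln1Dx _)); first by lra.
  rewrite lerN2 ler_pdivlMr // /w mulrA divfK; last by lra.
  by move: uu'; lra.
rewrite natrD in hab he2 *.
have := shift_arith s0 c0 K0 n0 r0' (ler0n _ k) w0 e20 erefl hk he2 he1 hK hab ha Lw L'.
move=> /le_trans; apply; rewrite lerD2r lerN2.
by rewrite ler_pM2l // ler_pM2l // divr_gt0.
Qed.

End Estimates.

(** * Transfer of the first moment bound from $p'$ to $p$ at fixed $n$ *)

Section Transfer.
Variable R : realType.
Implicit Types (p c K s eps eta : R) (n r k : nat).

(** If $np \ge 2$, the term $-(r+k)\ln(np)$ is already at most $-r\ln 2$. If $np < 2$, then $k \le
    r$ and $-\ln(np) \le \ln(1+1/\varepsilon)$, and the term in $c/s$ absorbs both this and $\ln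
    2$. *)
Lemma expected_dominating_shift_le n r k s c K eta1 eta2 eps :
  let p := s ^+ 2 in
  0 < s -> p <= 2^-1 -> 0 < c -> (0 < r)%N ->
  k%:R * (n%:R * s) <= c * r%:R -> c * s <= 2^-1 -> 4 * c <= K -> K < n%:R * s ->
  0 < eta2 -> eta2 * n%:R <= n%:R - (r + k)%:R ->
  eta1 <= p * r%:R -> 8 * c <= eta1 * eta2 * K ->
  expected_dominating n p r < (n%:R * p)^-1 ->
  0 < eps <= n%:R * p -> c * s <= eps ->
  s * (2 * ln (1 + eps^-1) + ln 2) <= c * expR (- 4) ->
  expected_dominating n (p - K * s / n%:R) (r + k) <= 2^-1.
Proof.
move=> p s0 p2 c0 r0 hk cs cK Kns e20 he2 he1 hK hE /andP[e0 ed] cse hs.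
have := ln_expected_dominating_shift s0 p2 c0 r0 hk cs cK Kns e20 he2 he1 hK hE.
rewrite -/p; set E := expected_dominating _ _ _ => hln.
have [E0|E0] := lerP E 0; first by apply: le_trans E0 _; rewrite invr_ge0.
rewrite -ler_ln ?posrE ?invr_gt0 // lnV ?posrE //.
have ln20 : 0 <= ln (2 : R) by rewrite ln_ge0 // ler1n.
have r0' : 0 < r%:R :> R by rewrite ltr0n.
have d0 : 0 < n%:R * p by apply: lt_le_trans ed.
have n0 : 0 < n%:R :> R by rewrite -(pmulr_lgt0 _ s0); lra.
have p0 : 0 < p by rewrite exprn_gt0.
have k0 : 0 <= k%:R :> R by [].
rewrite -(ler_pM2l r0'); apply: (le_trans hln); rewrite natrD.
have cu0 : 0 <= r%:R * (c / s * (1 - p) ^+ r).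
  by rewrite !mulr_ge0 ?invr_ge0 ?exprn_ge0 ?(ltW c0) ?(ltW s0) //; lra.
have [d2|d2] := lerP 2 (n%:R * p).
  have D2 : ln 2 <= ln (n%:R * p) by rewrite ler_ln ?posrE.
  have rk : 0 <= r%:R + k%:R :> R by lra.
  have := ler_wpM2l rk D2; have := mulr_ge0 k0 ln20; lra.
have kr : k%:R <= r%:R :> R.
  rewrite -(ler_pM2r (mulr_gt0 n0 s0)); apply: (le_trans hk).
  rewrite mulrC ler_pM2l //.
  by rewrite -(ler_pM2r s0) -mulrA -expr2 (le_trans cse).
(* Here $pr \le pn < 2$ and $1-p \ge e^{-2p}$. *)
have u4 : expR (- 4) <= (1 - p) ^+ r.
  apply: (@le_trans _ _ (expR (- (2 * p)) ^+ r)).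
    rewrite -expRM_natr ler_expR.
    have rn : r%:R <= n%:R :> R.
      have : 0 <= eta2 * n%:R by rewrite mulr_ge0 ?ltW.
      by move: he2; rewrite natrD; lra.
    have := ler_wpM2l (ltW p0) rn; lra.
  apply: lerXn2r; rewrite ?nnegrE ?expR_ge0 //; first by lra.
  by apply: expRN2_le; rewrite p2 ltW.
set Z := ln (1 + eps^-1) in hs.
have ei : 0 < eps^-1 by rewrite invr_gt0.
have Z0 : 0 <= Z by rewrite ln_ge0 //; lra.
have DZ : - ln (n%:R * p) <= Z.
  rewrite -lnV ?posrE // ler_ln ?posrE ?invr_gt0 //; last by lra.
  apply: (@le_trans _ _ eps^-1); last by lra.
  by rewrite lef_pV2 ?posrE.
have csu : 2 * Z + ln 2 <= c / s * (1 - p) ^+ r.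
  apply: (@le_trans _ _ (c / s * expR (- 4))).
    by rewrite mulrAC ler_pdivlMr // mulrC.
  by rewrite ler_pM2l // divr_gt0.
have := ler_wpM2l (ltW r0') csu.
have rk : 0 <= r%:R + k%:R :> R by lra.
have := ler_wpM2l rk DZ.
have := ler_wpM2r Z0 kr; lra.
Qed.

(* [p - K * sqrt p / n] shifts the number of edges by [O(K)] standard deviations. *)
Lemma gnp_pr_shift n s K (A : pred {set {set 'I_n}}) :
  let p := s ^+ 2 in let p' := p - K * s / n%:R in
  0 < s -> p <= 2^-1 -> 0 <= K -> K <= n%:R * s -> (0 < n)%N ->
  2^-1 <= gnp_pr p' A -> (4 * expR (2 * K ^+ 2))^-1 <= gnp_pr p A.
Proof.
move=> p p' s0 p2 K0 Kns n0 hA.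
have n0' : 0 < n%:R :> R by rewrite ltr0n.
have p0 : 0 < p by rewrite exprn_gt0.
have h0 : 0 <= K * s / n%:R by rewrite divr_ge0 ?mulr_ge0 // ltW.
have p'01 : 0 <= p' <= 1.
  apply/andP; split; last by rewrite /p'; lra.
  rewrite subr_ge0 ler_pdivrMr // /p expr2 mulrAC ler_pM2r //; lra.
have p01 : 0 < p < 1 by lra.
have B0 := expR_gt0 (2 * K ^+ 2).
(* The base is $1 + K^2/(n^2(1-p))$ with $1-p \ge 1/2$, and there are at most $n^2$ pairs. *)
have hB : (1 + (p' - p) ^+ 2 / (p * (1 - p))) ^+ #|vertex_pairs n| <= expR (2 * K ^+ 2).
  have -> : (p' - p) ^+ 2 / (p * (1 - p)) = K ^+ 2 / n%:R ^+ 2 / (1 - p).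
    rewrite /p' /p; field; rewrite !gt_eqF // -/p; lra.
  set t := _ / (1 - p).
  have t0 : 0 <= t by rewrite !divr_ge0 ?sqr_ge0 //; lra.
  apply: (@le_trans _ _ (expR t ^+ #|vertex_pairs n|)).
    apply: lerXn2r; rewrite ?nnegrE ?expR_ge0 ?expR_ge1Dx //; lra.
  rewrite -expRM_natr ler_expR.
  apply: (@le_trans _ _ (t * n%:R ^+ 2)).
    rewrite ler_wpM2l // -natrX ler_nat card_vertex_pairs bin2.
    by rewrite -divn2 (leq_trans (leq_div _ _)) // -mulnn leq_mul2l leq_pred orbT.
  have -> : t * n%:R ^+ 2 = K ^+ 2 / (1 - p).
    rewrite /t; field; rewrite !gt_eqF //; lra.
  rewrite ler_pdivrMr; last by lra.
  have := sqr_ge0 K; nra.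
have := gnp_pr_change A p01 p'01 B0 hB.
move: (gnp_pr p' A) (gnp_pr p A) (expR _) hA B0 {hB} => P' P e hA B0 hP.
rewrite -[(4 * e)^-1]mul1r ler_pdivrMr; lra.
Qed.

(** The result at a fixed $n$, with the demands on small $s = \sqrt p$ and large $n$ made explicit.
    [eta1] bounds $p\hat r$ below, [eta] bounds $1-\hat r/n$ below, and the second term of [K]
    yields $8c \le \eta_1(\eta/2)K$. *)
Lemma domination_lower n s c eps (K eta : R) :
  let p := s ^+ 2 in
  let eta1 := Num.min (32^-1) (eps / 4) in
  eta = (1 - expR (- (eps / 2))) / 2 ->
  K = 4 * c + 16 * c / (eta1 * eta) ->
  0 < s -> s <= 2^-1 -> 0 < c -> 0 < eps <= n%:R * p ->
  c * s <= 2^-1 -> K * s < eps -> c * s <= eps * (eta / 2) -> s <= eta1 ->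
  s * (2 * ln (1 + eps^-1) + ln 2) <= c * expR (- 4) ->
  eta^-1 <= n%:R -> (eta * eps)^-1 <= n%:R ->
  (4 * expR (2 * K ^+ 2))^-1 <= gnp_pr p (fun G : {set {set 'I_n}} =>
      (rhat n p)%:R + c * ((rhat n p)%:R / (n%:R * s)) < (domination_number G)%:R).
Proof.
move=> p eta1 Eeta EK s0 s2 c0 /andP[e0 ed] cs Ks cse se1 hs hn1 hn2.
have e10 : 0 < eta1 by rewrite lt_min invr_gt0 ltr0n divr_gt0.
have eta0 : 0 < eta.
  have : expR (- (eps / 2)) < 1 by rewrite expR_lt1; lra.
  rewrite Eeta; lra.
have eta2 : eta <= 2^-1.
  have := expR_gt0 (- (eps / 2)); rewrite Eeta; lra.
have ee0 : 0 < eta1 * eta by rewrite mulr_gt0.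
have K4 : 4 * c <= K by rewrite EK lerDl divr_ge0 ?mulr_ge0 ?ltW.
have K0 : 0 < K by lra.
have n0' : 0 < n%:R :> R by apply: lt_le_trans hn1; rewrite invr_gt0.
have n0 : (0 < n)%N by rewrite -(ltr0n R).
have p0 : 0 < p by rewrite exprn_gt0.
have pq : p <= 2^-1 * s by rewrite /p expr2 ler_pM2r.
have p2 : p <= 2^-1 by lra.
have p01 : 0 < p <= 1 by lra.
have ens : eps <= n%:R * s * s by rewrite -mulrA -expr2.
have ns0 : 0 < n%:R * s by rewrite mulr_gt0.
have Kns : K < n%:R * s by rewrite -(ltr_pM2r s0); lra.
pose m := Num.trunc (eta * n%:R).
have en0 : 0 <= eta * n%:R by rewrite mulr_ge0 ?ltW.
have /andP[m1 m2] := truncn_itv en0; rewrite -/m in m1 m2.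
have m0 : (0 < m)%N.
  rewrite -ltnS -(ltr_nat R); apply: le_lt_trans m2.
  by rewrite mulrC -ler_pdivrMr // mul1r.
have mn : (2 * m <= n)%N.
  rewrite -(ler_nat R) natrM; have := ler_wpM2r (ltW n0') eta2; lra.
have hm : eps^-1 <= 2 ^+ m.
  apply: (@le_trans _ _ m.+1%:R); last by rewrite -natrX ler_nat ltn_expl.
  apply: le_trans (ltW m2); rewrite mulrC -ler_pdivrMr //.
  by rewrite -invfM mulrC.
have e0d : 0 < eps <= n%:R * p by rewrite e0.
have hlarge : (n%:R * p)^-1 <= expected_dominating n p (n - m).
  by apply: (expected_dominating_large p01 e0d) => //; rewrite -Eeta.
have hsmall : expected_dominating n p 0 < (n%:R * p)^-1.
  by apply: expected_dominating_small; rewrite ?mulr0 ?invr_ge0.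
have [] := rhat_spec (leq_subr m n) hsmall hlarge.
move: (rhat n p) => r rm hr hr1.
(* At $\hat r+1$ the expectation is at least $1/d$, so [expected_dominating_small] must fail there:
   either $p(\hat r+1) > 1/16$ or $2(\hat r+1) > n$. The factor 2 pays for returning to $\hat r$, as
   $p \le \eta_1$. *)
have pr1 : 2 * eta1 <= p * r.+1%:R.
  have [h|h] := leqP (2 * r.+1)%N n.
    have [h'|/ltW h'] := lerP (p * r.+1%:R) (16^-1).
      by have := expected_dominating_small p01 n0 h h'; rewrite ltNge hr1.
    apply: le_trans h'.
    have : eta1 <= 32^-1 by rewrite ge_min lexx.
    lra.
  have h' : n%:R <= 2 * r.+1%:R :> R by rewrite -natrM ler_nat ltnW.
  have : eta1 <= eps / 4 by rewrite ge_min lexx orbT.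
  have := ler_wpM2l (ltW p0) h'; lra.
have pr : eta1 <= p * r%:R by move: pr1; rewrite -natr1; lra.
have r0 : (0 < r)%N.
  rewrite lt0n; apply/eqP => r0; move: pr; rewrite r0 mulr0; lra.
have r0' : 0 < r%:R :> R by rewrite ltr0n.
set t := c * _.
have t0 : 0 <= t by rewrite mulr_ge0 ?divr_ge0 ?ltW.
pose k := Num.trunc t.
have /andP[k1 k2] := truncn_itv t0; rewrite -/k in k1 k2.
have hk : k%:R * (n%:R * s) <= c * r%:R.
  by rewrite -ler_pdivlMr // -mulrA.
have rn : r%:R <= n%:R - eta * n%:R.
  have : r.+1%:R + m%:R <= n%:R :> R by rewrite -natrD ler_nat addSn addnC -ltn_subRL.
  by move: m2; rewrite -!natr1; lra.
(* The shift uses at most half of the room $\eta n$ above $\hat r$. *)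
have kn : k%:R <= eta / 2 * n%:R.
  rewrite -(ler_pM2r ns0); apply: (le_trans hk).
  rewrite -(ler_pM2r s0).
  apply: (@le_trans _ _ (c * s * n%:R)).
    rewrite mulrAC ler_pM2l ?mulr_gt0 //; lra.
  apply: (@le_trans _ _ (eps * (eta / 2) * n%:R)); first by rewrite ler_pM2r.
  have : 0 <= eta / 2 * n%:R by rewrite mulr_ge0 ?ltW //; lra.
  by move=> en; have := ler_wpM2l en ens; lra.
have he2 : eta / 2 * n%:R <= n%:R - (r + k)%:R by rewrite natrD; lra.
have hK : 8 * c <= eta1 * (eta / 2) * K.
  have -> : eta1 * (eta / 2) * K = 2 * c * (eta1 * eta) + 8 * c.
    by rewrite EK; field; rewrite !gt_eqF.
  by rewrite lerDr mulr_ge0 ?mulr_ge0 ?ltW.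
have cse' : c * s <= eps.
  apply: (le_trans cse); rewrite ler_piMr ?ltW //; lra.
have eta20 : 0 < eta / 2 by lra.
have hE := expected_dominating_shift_le s0 p2 c0 r0 hk cs K4 Kns eta20 he2 pr hK hr e0d cse' hs.
apply: (@gnp_pr_shift n s K) => //; [exact: ltW|exact: ltW|].
rewrite -/p in hE *; set p' := p - _ in hE *.
have p'01 : 0 <= p' <= 1.
  have h0 : 0 <= K * s / n%:R by rewrite divr_ge0 ?mulr_ge0 ?ltW.
  apply/andP; split; last by rewrite /p'; lra.
  rewrite subr_ge0 ler_pdivrMr // /p expr2 mulrAC ler_pM2r //; lra.
have rkn : (r + k <= n)%N by rewrite -(ler_nat R); have := mulr_gt0 eta20 n0'; lra.
rewrite gnp_prC.
have h := le_trans (gnp_pr_domination_le p'01 rkn) hE.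
rewrite lerBrDl -lerBrDr [1 - 2^-1](_ : _ = 2^-1); last by field.
(* The complementary event gives $D \le r+t < r+k+1$, hence $D \le r+k$ by integrality. *)
apply: le_trans h; apply: gnp_pr_le => // G; rewrite !unfold_in /= -leNgt => hG.
by rewrite -ltnS -(ltr_nat R) -addnS natrD; lra.
Qed.

End Transfer.

(** * Conclusion for sequences $p(n) \to 0$ *)

Local Open Scope classical_set_scope.

Theorem theorem1p4 (R : realType) :
  forall c eps : R, 0 < c -> 0 < eps ->
  exists delta : R, 0 < delta /\
  forall p : nat -> R,
    (forall n : nat, 0 <= p n <= 1) ->
    (\forall n \near \oo, eps / n%:R <= p n) ->
    p n @[n --> \oo] --> (0 : R) ->
  exists n0 : nat, forall n : nat, (n0 <= n)%N ->
    delta <= gnp_pr (p n) (fun G : {set {set 'I_n}} =>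
      (rhat n (p n))%:R
        + c * ((rhat n (p n))%:R / (n%:R * Num.sqrt (p n)))
      < (domination_number G)%:R).
Proof.
move=> c eps c0 e0.
pose eta1 : R := Num.min (32^-1) (eps / 4).
pose eta : R := (1 - expR (- (eps / 2))) / 2.
pose K : R := 4 * c + 16 * c / (eta1 * eta).
pose Z : R := 2 * ln (1 + eps^-1) + ln 2.
have e10 : 0 < eta1 by rewrite lt_min invr_gt0 ltr0n divr_gt0.
have eta0 : 0 < eta.
  have : expR (- (eps / 2)) < 1 by rewrite expR_lt1; lra.
  rewrite /eta; lra.
have K0 : 0 < K by rewrite /K addr_gt0 // ?divr_gt0 // mulr_gt0.
have Z0 : 0 < Z.
  apply: ltr_wpDl; last by rewrite ln_gt0 // ltr1n.
  by rewrite mulr_ge0 // ln_ge0 // lerDl invr_ge0 ltW.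
have ee0 : 0 < eps * (eta / 2) by rewrite mulr_gt0 // divr_gt0.
(* [K] depends on [c] and [eps] only, so the witness is fixed before [p]. *)
exists (4 * expR (2 * K ^+ 2))^-1; split.
  by rewrite invr_gt0 mulr_gt0 ?expR_gt0.
move=> p p01 hp p_to0.
have sqrt_small t : 0 < t -> \forall n \near \oo, Num.sqrt (p n) < t.
  move=> t0; have t20 : 0 < t ^+ 2 by rewrite exprn_gt0.
  near=> n; have pn : p n < t ^+ 2 by near: n; exact: cvgr_lt p_to0 _ t20.
  by rewrite -(ltr_pXn2r (n := 2)) ?nnegrE ?sqrtr_ge0 ?ltW // sqr_sqrtr //; case/andP: (p01 n).
suff [N _ HN] : \forall n \near \oo, (4 * expR (2 * K ^+ 2))^-1 <=
    gnp_pr (p n) (fun G : {set {set 'I_n}} =>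
      (rhat n (p n))%:R + c * ((rhat n (p n))%:R / (n%:R * Num.sqrt (p n)))
      < (domination_number G)%:R).
  by exists N => n Nn; apply: HN.
near=> n.
have n0 : 0 < n%:R :> R.
  by rewrite ltr0n; near: n; exact: nbhs_infty_gt.
have hpn : eps / n%:R <= p n by near: n.
have p0 : 0 < p n by apply: lt_le_trans hpn; rewrite divr_gt0.
have Ep : Num.sqrt (p n) ^+ 2 = p n by rewrite sqr_sqrtr // ltW.
have s0 : 0 < Num.sqrt (p n) by rewrite sqrtr_gt0.
have small a b : 0 < a -> 0 < b -> Num.sqrt (p n) < b / a -> a * Num.sqrt (p n) < b.
  by move=> a0 b0; rewrite ltr_pdivlMr // mulrC.
have := @domination_lower R n (Num.sqrt (p n)) c eps K eta; rewrite Ep; apply => //.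
- by apply: ltW; near: n; apply: sqrt_small; rewrite invr_gt0.
- by rewrite e0 mulrC -ler_pdivrMr.
- by apply/ltW/small => //; near: n; apply: sqrt_small; rewrite divr_gt0.
- by apply: small => //; near: n; apply: sqrt_small; rewrite divr_gt0.
- by apply/ltW/small => //; near: n; apply: sqrt_small; rewrite divr_gt0.
- by apply: ltW; near: n; apply: sqrt_small.
- rewrite mulrC; apply/ltW/small => //; first by rewrite mulr_gt0 ?expR_gt0.
  by near: n; apply: sqrt_small; rewrite divr_gt0 ?mulr_gt0 ?expR_gt0.
- by near: n; exact: nbhs_infty_ger.
- by near: n; exact: nbhs_infty_ger.
Unshelve. all: by end_near.
Qed.
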